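(* Let $0<\varepsilon\le1$. The series $\sum_{j=1}^\infty\frac{\phi_j(x)\phi_j(y)}{\lambda_j^2}$ converges uniformly for $(x,y)\in[0,1]^2\setminus(0,\varepsilon)^2$. For all $0\le x,y\le1$ this series is absolutely convergent, and $$\sum_{j=1}^\infty\frac{\phi_j(x)\phi_j(y)}{\lambda_j^2}=K_2(x,y).$$
   Context: Let $K:[0,1]\times[0,1]\to\mathbb R$ be defined by $K(x,y)=\frac12-\{(xy)^{-1}\}$ if $0<x,y\le 1$, and $K(x,y)=0$ if $0\le x,y\le1$ and $xy=0$, where $\{\alpha\}=\alpha-\lfloor\alpha\rfloor$. Define $K_2(x,y)=\int_0^1K(x,z)K(z,y)\,dz$ for $0\le x,y\le1$. Let $L^2([0,1])$ denote the space of real-valued Lebesgue measurable square-integrable functions on $[0,1]$, with $\langle f,g\rangle=\int_0^1 f(x)g(x)\,dx$ and $\|f\|=\langle f,f\rangle^{1/2}$. A function $\phi$ is an eigenfunction of $K$ (with eigenvalue $\lambda\in\mathbb R$) if $\phi\in L^2([0,1])$, $\|\phi\|>0$, and $\phi(x)=\lambda\int_0^1 K(x,y)\phi(y)\,dy$ for every $x\in[0,1]$. Let $\phi_1,\phi_2,\ldots$ be a maximal orthonormal system in $L^2([0,1])$ of eigenfunctions of $K$, $\phi_j$ having the nonzero real eigenvalue $\lambda_j$, numbered so that $0<|\lambda_1|\le|\lambda_2|\le\cdots$ and $\lambda_j\ge\lambda_{j+1}$ whenever $|\lambda_j|=|\lambda_{j+1}|$. *)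

(* Defs.v *)
From HB Require Import structures.
From mathcomp Require Import all_boot all_order all_algebra.
From mathcomp Require Import all_classical all_reals all_analysis.
Set Implicit Arguments. Unset Strict Implicit. Unset Printing Implicit Defensive.
Import Order.TTheory GRing.Theory Num.Theory.
Import numFieldNormedType.Exports.
Local Open Scope classical_set_scope.
Local Open Scope ring_scope.

Section Defs.
Variable R : realType.

Definition I01 : set R := `[0, 1]%classic.

Definition frac (a : R) : R := a - (Num.floor a)%:~R.

(* K(x,y) = 1/2 - {(xy)^-1} if xy <> 0, and 0 if xy = 0
   (only ever evaluated on [0,1]^2) *)
Definition K (x y : R) : R :=
  if x * y == 0 then 0 else 2^-1 - frac ((x * y)^-1).

Definition int01 (f : R -> R) : R := Rintegral lebesgue_measure I01 f.

Definition K2 (x y : R) : R := int01 (fun z => K x z * K z y).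

Definition L2 (f : R -> R) : Prop :=
  measurable_fun I01 f /\
  (\int[lebesgue_measure]_(x in I01) ((f x) ^+ 2)%:E < +oo)%E.

Definition inner (f g : R -> R) : R := int01 (fun x => f x * g x).
Definition norm2 (f : R -> R) : R := Num.sqrt (inner f f).

Definition eigenfunction (phi : R -> R) (lam : R) : Prop :=
  L2 phi /\ 0 < norm2 phi /\
  forall x, x \in I01 -> phi x = lam * int01 (fun y => K x y * phi y).

(* phi_1, phi_2, ... (indexed from 0 here) is a maximal orthonormal system
   in L^2([0,1]) of eigenfunctions of K, phi j having the nonzero eigenvalue
   lam j, numbered so that 0 < |lam 0| <= |lam 1| <= ... and
   lam j >= lam (j+1) whenever |lam j| = |lam (j+1)|. *)
Definition eigen_system (phi : nat -> R -> R) (lam : nat -> R) : Prop :=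
  (forall j, lam j != 0 /\ eigenfunction (phi j) (lam j)) /\
  (forall i j, inner (phi i) (phi j) = (i == j)%:R) /\
  (forall (psi : R -> R) (mu : R), eigenfunction psi mu ->
      ~ (forall j, inner psi (phi j) = 0)) /\
  (0 < `|lam 0|) /\
  (forall j, `|lam j| <= `|lam j.+1|) /\
  (forall j, `|lam j| = `|lam j.+1| -> lam j.+1 <= lam j).

End Defs.

(* Main.v *)
Require Import Defs.
From HB Require Import structures.
From mathcomp Require Import all_boot all_order all_algebra.
From mathcomp Require Import all_classical all_reals all_analysis.
From mathcomp Require Import measurable_realfun ring lra.
Import Order.TTheory GRing.Theory Num.Theory.
Import numFieldNormedType.Exports.
Local Open Scope classical_set_scope.
Local Open Scope ring_scope.
Set Implicit Arguments.
Unset Strict Implicit.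
Unset Printing Implicit Defensive.

(* Write [T f x = <K(x,.), f>] ([Kop f x]) and [d(x,y) = ||K(x,.) - K(y,.)||].
   By dominated convergence [d] is continuous at every [x > 0], so any [f] with
   [|f x - f y| <= C d(x,y)] is bounded and continuous on ]0,1]; for fixed [C]
   such functions are equicontinuous on compact subsets of ]0,1], where pointwise
   convergence along a filter is therefore uniform. This replaces both the
   compactness of [T] and Dini's theorem, and lets every argument stay within
   bounded measurable functions, without the completeness of L^2.

   If [T f <> 0] for some [f] orthogonal to all [phi_j], take a maximizing
   sequence [f_n] of [||T f||^2] over the unit ball of that orthogonal, with
   supremum [m]. An ultrafilter limit [g] of [T f_n] satisfies [T^2 g = m g] and
   [||g||^2 = m], and [T g + sqrt m g] or [g] is an eigenfunction, contradicting
   maximality.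

   Let [k_n(x,.)] ([Kres n x]) be [K(x,.)] minus its projection on
   [phi_0, ..., phi_{n-1}]. Then [T (k_n(x,.)) y = <k_n(x,.), k_n(y,.)>] is
   [K_2(x,y)] minus the n-th partial sum. Its limit [q(y)] is orthogonal to
   all [phi_j], so [T q = 0] in L^2 and [<q,q> = lim <T q, k_n(x,.)> = 0],
   whence [q = 0] everywhere by continuity.
   Uniformity follows from [<k_n(x,.), k_n(y,.)>^2 <= <k_n(x,.), k_n(x,.)>]. *)

(** * Bounded measurable functions on [0,1] and their inner product *)

Section BoundedMeasurable.
Context {R : realType}.
Implicit Types (f g h : R -> R) (a c x y : R).
Local Notation mu := (@lebesgue_measure R).
Local Notation I := (@I01 R).

Lemma I01E x : I x = (0 <= x <= 1) :> Prop.
Proof. by rewrite /I01 /= in_itv. Qed.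

Lemma measurable_I01 : measurable I.
Proof. exact: measurable_itv. Qed.
Hint Resolve measurable_I01 : core.

Lemma lebesgue_measure_I01 : mu I = 1%E.
Proof. by rewrite /I01 lebesgue_measure_itv /= lte01 oppr0 adde0. Qed.

(** The bound holds everywhere on [0,1], not almost everywhere. The class is closed under products
    and consists of integrable functions, so inner products carry no separate integrability
    conditions. *)
Definition bmeas f :=
  measurable_fun I f /\ exists M, forall x, I x -> `|f x| <= M.

Lemma bmeas_integrable f : bmeas f -> mu.-integrable I (EFin \o f).
Proof.
case=> mf [M fM]; apply: measurable_bounded_integrable => //.
  by rewrite [X in (X < _)%E]lebesgue_measure_I01 ltry.
exists M; split; first exact: num_real.
by move=> N MN x Ix /=; rewrite (le_trans (fM x Ix))// ltW.
Qed.

Lemma bmeas_cst c : bmeas (fun=> c).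
Proof. by split; [exact: measurable_cst|exists `|c|]. Qed.

Lemma bmeasD f g : bmeas f -> bmeas g -> bmeas (fun x => f x + g x).
Proof.
move=> [mf [M fM]] [mg [N gN]]; split; first exact: measurable_funD.
by exists (M + N) => x Ix; rewrite (le_trans (ler_normD _ _))// lerD// ?fM ?gN.
Qed.

Lemma bmeasM f g : bmeas f -> bmeas g -> bmeas (fun x => f x * g x).
Proof.
move=> [mf [M fM]] [mg [N gN]]; split; first exact: measurable_funM.
by exists (M * N) => x Ix; rewrite normrM ler_pM// ?fM ?gN.
Qed.

Lemma bmeasZ c f : bmeas f -> bmeas (fun x => c * f x).
Proof. by apply: bmeasM; exact: bmeas_cst. Qed.

Lemma bmeasN f : bmeas f -> bmeas (fun x => - f x).
Proof.
by move=> /(bmeasZ (-1)); under eq_fun do rewrite mulN1r.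
Qed.

Lemma bmeasB f g : bmeas f -> bmeas g -> bmeas (fun x => f x - g x).
Proof. by move=> bf bg; apply: bmeasD => //; exact: bmeasN. Qed.

Lemma bmeasX f n : bmeas f -> bmeas (fun x => f x ^+ n).
Proof.
move=> bf; elim: n => [|n IH]; first exact: bmeas_cst.
by under eq_fun do rewrite exprS; exact: bmeasM.
Qed.

Lemma bmeas_norm f : bmeas f -> bmeas (fun x => `|f x|).
Proof.
move=> [mf [M fM]]; split; first exact: measurableT_comp.
by exists M => x Ix; rewrite normr_id fM.
Qed.

Lemma bmeas_sum n (F : nat -> R -> R) : (forall i, bmeas (F i)) ->
  bmeas (fun x => \sum_(i < n) F i x).
Proof.
move=> bF; elim: n => [|n IH].
  by under eq_fun do rewrite big_ord0; exact: bmeas_cst.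
by under eq_fun do rewrite big_ord_recr; exact: bmeasD.
Qed.

Lemma bmeas_indic (A : set R) : measurable A -> bmeas (\1_A : R -> R).
Proof.
move=> mA; split; first exact: measurable_indic.
by exists 1 => x _; rewrite indicE ger0_norm ?ler0n// lern1 leq_b1.
Qed.

Lemma eq_int01 f g : (forall x, I x -> f x = g x) -> int01 f = int01 g.
Proof. by move=> fg; apply: eq_Rintegral => x; rewrite inE; exact: fg. Qed.

Lemma int01D f g : bmeas f -> bmeas g ->
  int01 (fun x => f x + g x) = int01 f + int01 g.
Proof. by move=> bf bg; apply: RintegralD => //; exact: bmeas_integrable. Qed.

Lemma int01Z c f : bmeas f -> int01 (fun x => c * f x) = c * int01 f.
Proof. by move=> bf; apply: RintegralZl => //; exact: bmeas_integrable. Qed.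

Lemma int01_ge0 f : (forall x, I x -> 0 <= f x) -> 0 <= int01 f.
Proof. by move=> f0; rewrite /int01; apply: Rintegral_ge0. Qed.

Lemma le_int01 f g : bmeas f -> bmeas g ->
  (forall x, I x -> f x <= g x) -> int01 f <= int01 g.
Proof.
by move=> bf bg fg; rewrite /int01; apply: le_Rintegral => //; exact: bmeas_integrable.
Qed.

Lemma int01_cst c : int01 (fun=> c) = c.
Proof.
by rewrite /int01 Rintegral_cst// [X in fine X]lebesgue_measure_I01 /= mulr1.
Qed.

Lemma le_norm_int01 f : bmeas f -> `|int01 f| <= int01 (fun x => `|f x|).
Proof. by move=> bf; apply: le_normr_Rintegral => //; exact: bmeas_integrable. Qed.

Lemma int01_indic (A : set R) : measurable A -> A `<=` I ->
  int01 \1_A = fine (mu A).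
Proof.
move=> mA AI; rewrite /int01 /Rintegral integral_indic//.
by rewrite setIidl.
Qed.

Lemma eq_inner f f' g g' : (forall x, I x -> f x = f' x) ->
  (forall x, I x -> g x = g' x) -> inner f g = inner f' g'.
Proof. by move=> ff' gg'; apply: eq_int01 => x Ix; rewrite ff'// gg'. Qed.

Lemma innerC f g : inner f g = inner g f.
Proof. by apply: eq_int01 => x _; rewrite mulrC. Qed.

Lemma innerDl f g h : bmeas f -> bmeas g -> bmeas h ->
  inner (fun x => f x + g x) h = inner f h + inner g h.
Proof.
move=> bf bg bh; rewrite /inner -int01D//; try exact: bmeasM.
by apply: eq_int01 => x _; rewrite mulrDl.
Qed.

Lemma innerZl c f g : bmeas f -> bmeas g ->
  inner (fun x => c * f x) g = c * inner f g.
Proof.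
move=> bf bg; rewrite /inner -int01Z; last exact: bmeasM.
by apply: eq_int01 => x _; rewrite mulrA.
Qed.

Lemma innerBl f g h : bmeas f -> bmeas g -> bmeas h ->
  inner (fun x => f x - g x) h = inner f h - inner g h.
Proof.
move=> bf bg bh; rewrite -[- inner g h]mulN1r -innerZl// -innerDl//.
  by apply: eq_inner => // x _; rewrite mulN1r.
exact: bmeasZ.
Qed.

Lemma innerDr f g h : bmeas f -> bmeas g -> bmeas h ->
  inner h (fun x => f x + g x) = inner h f + inner h g.
Proof. by move=> bf bg bh; rewrite innerC innerDl// !(innerC h). Qed.

Lemma innerZr c f g : bmeas f -> bmeas g ->
  inner g (fun x => c * f x) = c * inner g f.
Proof. by move=> bf bg; rewrite innerC innerZl// (innerC g). Qed.

Lemma innerBr f g h : bmeas f -> bmeas g -> bmeas h ->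
  inner h (fun x => f x - g x) = inner h f - inner h g.
Proof. by move=> bf bg bh; rewrite innerC innerBl// !(innerC h). Qed.

Lemma inner_sumr n (F : nat -> R -> R) g : (forall i, bmeas (F i)) -> bmeas g ->
  inner g (fun x => \sum_(i < n) F i x) = \sum_(i < n) inner g (F i).
Proof.
move=> bF bg; elim: n => [|n IH].
  rewrite big_ord0 -[RHS](int01_cst 0); apply: eq_int01 => x _.
  by rewrite big_ord0 mulr0.
rewrite big_ord_recr /= -IH -innerDr//; last exact: bmeas_sum.
by apply: eq_inner => // x _; rewrite big_ord_recr.
Qed.

Lemma inner_ge0 f : 0 <= inner f f.
Proof. by apply: int01_ge0 => x _; rewrite -expr2 sqr_ge0. Qed.

(** The quadratic ||f - t g||^2 in [t] is nonnegative; for [c > 0] its minimum, at [t = b / c],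
    gives the inequality. *)
Lemma cauchy_schwarz f g : bmeas f -> bmeas g ->
  inner f g ^+ 2 <= inner f f * inner g g.
Proof.
move=> bf bg; set a := inner f f; set b := inner f g; set c := inner g g.
have quad t : 0 <= a - 2 * t * b + t ^+ 2 * c.
  have -> : a - 2 * t * b + t ^+ 2 * c =
      inner (fun x => f x - t * g x) (fun x => f x - t * g x).
    have btg := bmeasZ t bg; have bd := bmeasB bf btg.
    rewrite innerBl// !innerBr// !innerZl// !innerZr// (innerC g f) -/a -/b -/c.
    by ring.
  exact: inner_ge0.
have c0 : 0 <= c by exact: inner_ge0.
have [c_gt0|] := ltP 0 c; last first.
  move=> c_le0; have c_eq0 : c = 0 by apply/eqP; rewrite eq_le c_le0 c0.
  have [b0|b0] := eqVneq b 0; first by rewrite b0 expr0n /= c_eq0 mulr0.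
  (* With [c = 0] the quadratic is affine in [t], and this [t] would give it the value -1. *)
  have := quad ((a + 1) / (2 * b)); rewrite c_eq0 mulr0 addr0.
  have -> : 2 * ((a + 1) / (2 * b)) * b = a + 1 by field.
  lra.
have := quad (b / c).
have -> : a - 2 * (b / c) * b + (b / c) ^+ 2 * c = (a * c - b ^+ 2) / c.
  by field; rewrite gt_eqF.
by rewrite pmulr_lge0 ?invr_gt0// subr_ge0.
Qed.

Lemma norm2_ge0 f : 0 <= norm2 f.
Proof. exact: sqrtr_ge0. Qed.

Lemma sqr_norm2 f : norm2 f ^+ 2 = inner f f.
Proof. by rewrite sqr_sqrtr// inner_ge0. Qed.

Lemma le_norm_inner f g : bmeas f -> bmeas g ->
  `|inner f g| <= norm2 f * norm2 g.
Proof.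
move=> bf bg; rewrite -ler_sqr ?nnegrE ?mulr_ge0 ?norm2_ge0//.
by rewrite exprMn !sqr_norm2 -normrX ger0_norm ?sqr_ge0// cauchy_schwarz.
Qed.

Lemma norm2_le f a : 0 <= a -> inner f f <= a ^+ 2 -> norm2 f <= a.
Proof. by move=> a0 fa; rewrite -ler_sqr ?nnegrE ?norm2_ge0// sqr_norm2. Qed.

Lemma bmeas_L2 f : bmeas f -> L2 f.
Proof.
move=> bf; split; first by case: bf.
have /integrableP[_] := bmeas_integrable (bmeasX 2 bf).
apply: le_lt_trans; apply: ge0_le_integral => //=.
- by move=> x _; rewrite lee_fin sqr_ge0.
- by apply/measurable_EFinP; case: (bmeasX 2 bf).
- by do 2 apply: measurableT_comp => //; case: (bmeasX 2 bf).
- by move=> x _; rewrite lee_fin ler_norm.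
Qed.

End BoundedMeasurable.


(** * Exchange of integrals on the unit square *)

Section Fubini01.
Context {R : realType}.
Local Notation mu := (@lebesgue_measure R).
Local Notation I := (@I01 R).

Lemma section_bmeas (F : R -> R -> R) (M : R) x : I x ->
  measurable_fun setT (fun p : R * R => F p.1 p.2) ->
  (forall x y, I x -> I y -> `|F x y| <= M) -> bmeas (F x).
Proof.
move=> Ix mF FM; split; last by exists M => y; exact: FM.
apply: measurable_funTS.
exact: (measurableT_comp mF (pair1_measurable x)).
Qed.

(** The indicator factors cut [F] off outside the square, so that both integrals run over the whole
    line, where Fubini's theorem is applied. *)
Lemma int01_int01E (F : R -> R -> R) (M : R) :
  measurable_fun setT (fun p : R * R => F p.1 p.2) ->
  (forall x y, I x -> I y -> `|F x y| <= M) ->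
  int01 (fun x => int01 (F x)) =
  fine (\int[mu]_x \int[mu]_y (F x y * (\1_I x * \1_I y))%:E)%E.
Proof.
move=> mF FM; rewrite /int01 {1}/Rintegral integral_mkcond; congr fine.
apply: eq_integral => x _; rewrite patchE; case: ifPn => [/set_mem Ix|/negP xI].
  have bF := section_bmeas Ix mF FM.
  rewrite /Rintegral fineK; last first.
    by apply: integrable_fin_num => //; [exact: measurable_I01|exact: bmeas_integrable].
  rewrite integral_mkcond; apply: eq_integral => y _.
  rewrite patchE !indicE (mem_set Ix) mul1r; case: ifPn => _ /=.
    by rewrite mulr1.
  by rewrite mulr0.
rewrite -[LHS](@integral0 _ _ _ mu setT); apply: eq_integral => y _.
by rewrite indicE (negbTE (introN idP xI)) mul0r mulr0.
Qed.

Lemma int01_swap (F : R -> R -> R) (M : R) :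
  measurable_fun setT (fun p : R * R => F p.1 p.2) ->
  (forall x y, I x -> I y -> `|F x y| <= M) ->
  int01 (fun x => int01 (F x)) = int01 (fun y => int01 (F ^~ y)).
Proof.
move=> mF FM.
have mF' : measurable_fun setT (fun p : R * R => F p.2 p.1).
  exact: (measurableT_comp mF (@measurable_swap _ _ _ _)).
have FM' x y : I x -> I y -> `|F y x| <= M by move=> *; exact: FM.
rewrite (int01_int01E mF FM) (int01_int01E mF' FM'); congr fine.
pose G (p : R * R) := (F p.1 p.2 * (\1_I p.1 * \1_I p.2))%:E.
have mI : measurable_fun setT (\1_I : R -> R).
  by apply: measurable_indic; exact: (@measurable_I01 R).
have mG : measurable_fun setT G.
  apply/measurable_EFinP; apply: measurable_funM => //.
  by apply: measurable_funM; [exact: measurableT_comp mI measurable_fst|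
    exact: measurableT_comp mI measurable_snd].
transitivity (\int[mu]_x \int[mu]_y G (x, y))%E; first by [].
rewrite Fubini; last first.
  apply/integrable12ltyP => //.
  (* The cut-off integrand is dominated by [|M|] times the indicator of the square, whose double
     integral is [|M|]. *)
  apply: (@le_lt_trans _ _ (\int[mu]_x \int[mu]_y (`|M| * (\1_I x * \1_I y))%:E)%E).
    apply: ge0_le_integral => //.
    - by move=> x _; apply: integral_ge0 => y _; exact: abse_ge0.
    - have maG : measurable_fun setT (abse \o G) by exact: measurableT_comp.
      exact: (@measurable_fun_fubini_tonelli_F _ _ _ _ _ mu _ maG (fun=> abse_ge0 _)).
    - apply: (@measurable_fun_fubini_tonelli_F _ _ _ _ _ mu
        (fun p : R * R => (`|M| * (\1_I p.1 * \1_I p.2))%:E)); last first.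
        by move=> p; rewrite lee_fin !mulr_ge0.
      apply/measurable_EFinP; apply: measurable_funM => //.
      by apply: measurable_funM; [exact: measurableT_comp mI measurable_fst|
        exact: measurableT_comp mI measurable_snd].
    move=> x _; apply: ge0_le_integral => //.
    - apply: measurableT_comp => //.
      exact: (measurableT_comp mG (pair1_measurable x)).
    - apply/measurable_EFinP; apply: measurable_funM => //.
      exact: measurable_funM.
    move=> y _; rewrite /G /= lee_fin !normrM !indicE.
    case: (boolP (x \in I)) => [|_]; last by rewrite normr0 !mul0r !mulr0.
    case: (boolP (y \in I)) => [|_]; last by rewrite normr0 !mulr0.
    rewrite !inE !normr1 !mulr1 => Iy Ix; rewrite (le_trans (FM _ _ Ix Iy))//.
    exact: ler_norm.
  have intI (c : R) : 0 <= c -> (\int[mu]_x (c * \1_I x)%:E = c%:E)%E.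
    move=> c0; under eq_integral do rewrite EFinM.
    rewrite ge0_integralZl//; last exact/measurable_EFinP.
    rewrite integral_indic ?setIT//; last exact: measurable_I01.
    by rewrite [X in (_ * X)%E]lebesgue_measure_I01 mule1.
  rewrite (_ : (\int[mu]_x _)%E = `|M|%:E) ?ltry//.
  rewrite -[RHS]intI//; apply: eq_integral => x _.
  under eq_integral do rewrite mulrA.
  by rewrite intI// mulr_ge0.
apply: eq_integral => y _; apply: eq_integral => x _.
by rewrite /G /= [\1_I y * _]mulrC.
Qed.

End Fubini01.

(** * The kernel and its integral operator *)

Section Kernel.
Context {R : realType}.
Implicit Types (f g : R -> R) (x y z : R).
Local Notation mu := (@lebesgue_measure R).
Local Notation I := (@I01 R).

Lemma K_sym x y : K x y = K y x.
Proof. by rewrite /K mulrC. Qed.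

Lemma K0l y : K 0 y = 0.
Proof. by rewrite /K mul0r eqxx. Qed.

Lemma normK_le x y : `|K x y| <= 2^-1.
Proof.
rewrite /K; case: ifPn => _; first by rewrite normr0 invr_ge0.
have := floor_itv ((x * y)^-1); rewrite /Defs.frac intrD mulr1z.
set a := (x * y)^-1; set m := (Num.floor a)%:~R => /andP[m1 m2].
by rewrite ler_norml; apply/andP; split; lra.
Qed.

(** Inversion is continuous on the open set of nonzero reals, and [0^-1 = 0] settles the remaining
    point. *)
Lemma measurable_inv : measurable_fun setT (@GRing.inv R).
Proof.
rewrite (_ : GRing.inv = fun x => if x == 0 then 0 else x^-1); last first.
  by apply/funext => x; case: eqP => // ->; rewrite invr0.
apply: measurable_fun_if => //.
- exact: measurable_fun_eqr.
rewrite setTI (_ : _ @^-1` _ = [set x : R | x != 0]); last first.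
  by apply/seteqP; split => x /=; case: eqP.
apply: open_continuous_measurable_fun; first exact: open_neq.
by move=> x; rewrite inE; exact: inv_continuous.
Qed.

Lemma measurable_K : measurable_fun setT (fun p : R * R => K p.1 p.2).
Proof.
have mxy : measurable_fun setT (fun p : R * R => p.1 * p.2).
  exact: measurable_funM.
apply: measurable_fun_ifT => //.
  exact: measurable_fun_eqr.
apply: measurable_funB => //.
have mi : measurable_fun setT (fun p : R * R => (p.1 * p.2)^-1).
  exact: measurableT_comp measurable_inv mxy.
apply: measurable_funB => //.
apply: (@measurableT_comp _ _ _ _ _ _ (fun a : R => (Num.floor a)%:~R : R)) => //.
apply: nondecreasing_measurable => // a b ab.
by rewrite ler_int le_floor.
Qed.

Lemma bmeas_K x : bmeas (K x).
Proof.
split; last by exists 2^-1 => y _; exact: normK_le.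
apply: measurable_funTS.
exact: (measurableT_comp measurable_K (pair1_measurable x)).
Qed.

Definition Kop f x := int01 (fun y => K x y * f y).

(** Fubini and the symmetry of [K] make [Kop] self-adjoint. *)
Lemma inner_Kop f g : bmeas f -> bmeas g -> inner f (Kop g) = inner (Kop f) g.
Proof.
move=> bf bg; have [mf [M fM]] := bf; have [mg [N gN]] := bg.
(* [f] and [g] are measurable only on [0,1]; restricting them to it makes [F] measurable on the
   plane. *)
pose F x y := (f \_ I) x * (K x y * (g \_ I) y).
have mf' : measurable_fun setT (f \_ I).
  by apply/(measurable_restrictT _ _).1 => //; exact: measurable_I01.
have mg' : measurable_fun setT (g \_ I).
  by apply/(measurable_restrictT _ _).1 => //; exact: measurable_I01.
have mF : measurable_fun setT (fun p : R * R => F p.1 p.2).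
  apply: measurable_funM; first exact: measurableT_comp mf' measurable_fst.
  apply: measurable_funM; first exact: measurable_K.
  exact: measurableT_comp mg' measurable_snd.
have FM x y : I x -> I y -> `|F x y| <= M * (2^-1 * N).
  move=> Ix Iy; rewrite /F !patchE !mem_set// !normrM ler_pM ?mulr_ge0// ?fM//.
  by rewrite ler_pM// ?normK_le ?gN.
have := int01_swap mF FM.
rewrite (_ : int01 _ = inner f (Kop g)); last first.
  apply: eq_int01 => x Ix; rewrite /Kop -int01Z; last first.
    by apply: bmeasM => //; exact: bmeas_K.
  by apply: eq_int01 => y Iy; rewrite /F !patchE !mem_set.
move=> ->; apply: eq_int01 => y Iy; rewrite mulrC /Kop -int01Z; last first.
  by apply: bmeasM => //; exact: bmeas_K.
apply: eq_int01 => x Ix; rewrite /F !patchE !mem_set// (K_sym y) /=; ring.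
Qed.

End Kernel.


(** * The distance between kernel sections and the functions Lipschitz for it *)

Section KernelContinuity.
Context {R : realType}.
Implicit Types (f g : R -> R) (x y z : R).
Local Notation mu := (@lebesgue_measure R).
Local Notation I := (@I01 R).

(** Near a non-integer the floor is constant. *)
Lemma frac_continuous (a : R) : a <> (Num.floor a)%:~R ->
  {for a, continuous (@Defs.frac R)}.
Proof.
move=> aZ; have /andP[m1 m2] := floor_itv a.
apply: cvgB; first exact: cvg_id.
apply: cvg_near_cst; near=> b; congr (_%:~R).
apply/eqP; rewrite floor_eq; apply/andP; split; last by near: b; exact: lt_nbhsl.
rewrite ltW//; near: b; apply: lt_nbhsr.
by rewrite lt_neqAle m1 andbT; apply/eqP => /esym.
Unshelve. all: by end_near. Qed.

Lemma K_continuous x z : 0 < x -> 0 < z ->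
  (x * z)^-1 <> (Num.floor (x * z)^-1)%:~R -> K y z @[y --> x] --> K x z.
Proof.
move=> x0 z0 xz.
have xz0 : x * z != 0 by rewrite mulf_neq0// gt_eqF.
have -> : K x z = 2^-1 - Defs.frac (x * z)^-1 by rewrite /K (negbTE xz0).
apply: cvg_trans (_ : (fun y => 2^-1 - Defs.frac (y * z)^-1) @ x --> _).
  apply: near_eq_cvg; near=> y; rewrite /K ifF//.
  apply/negbTE; rewrite mulf_neq0 ?(gt_eqF z0)//.
  by rewrite gt_eqF//; near: y; exact: lt_nbhsr.
apply: cvgB; first exact: cvg_cst.
apply: (@cvg_comp _ _ _ (fun y => (y * z)^-1) _ _ (nbhs (x * z)^-1)); last first.
  exact: frac_continuous.
apply: cvgV => //; apply: cvgMl; exact: cvg_id.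
Unshelve. all: by end_near. Qed.

Definition dK x y : R := norm2 (fun z => K x z - K y z).

Lemma dK_ge0 x y : 0 <= dK x y. Proof. exact: norm2_ge0. Qed.

Lemma bmeas_KB x y : bmeas (fun z => K x z - K y z).
Proof. by apply: bmeasB; exact: bmeas_K. Qed.

Lemma normKB_le x y z : `|K x z - K y z| <= 1.
Proof.
have := ler_normB (K x z) (K y z); have := normK_le x z; have := normK_le y z; lra.
Qed.

Lemma dK_le1 x y : dK x y <= 1.
Proof.
apply: norm2_le => //; rewrite expr1n -[leRHS](int01_cst 1).
apply: le_int01; [by apply: bmeasM; exact: bmeas_KB|exact: bmeas_cst|].
by move=> z _; rewrite -expr2 -real_normK ?num_real// expr_le1// normKB_le.
Qed.

(** Dominated convergence with bound 1: for fixed [x > 0], [K y z] tends to [K x z] as [y] tends to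
    [x], except for the countably many [z] that are 0 or make [(x * z)^-1] an integer. *)
Lemma dK_cvg x (u : nat -> R) : 0 < x -> u n @[n --> \oo] --> x ->
  dK (u n) x @[n --> \oo] --> (0 : R).
Proof.
move=> x0 ux; rewrite -[X in _ --> X]sqrtr0.
apply: (@cvg_comp _ _ _ (fun n => inner (fun z => K (u n) z - K x z)
  (fun z => K (u n) z - K x z)) _ _ (nbhs (0:R))); last exact: sqrt_continuous.
apply: fine_cvg; rewrite -[X in _ --> X](@integral0 _ _ _ mu I).
pose f_ n z := ((K (u n) z - K x z) * (K (u n) z - K x z))%:E.
have [] := @dominated_convergence _ _ _ mu I (@measurable_I01 R) f_ (cst 0%E) (cst 1%E).
- move=> n; apply/measurable_EFinP.
  by have [] := bmeasM (bmeas_KB (u n) x) (bmeas_KB (u n) x).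
- exact: measurable_cst.
(* The index [m = 0] contributes the point 0, because [0^-1 = 0]. *)
- pose A := range (fun m : int => (x * m%:~R)^-1).
  have cA : countable A by apply: sub_countable (card_image_le _ _) (countableP _).
  exists A; split.
  + by apply: countable_measurable => // t; exact: measurable_set1.
  + exact: countable_lebesgue_measure0.
  move=> z /= /not_implyP[Iz nz]; apply: contrapT => zA; apply: nz.
  have z0 : 0 < z.
    rewrite lt_neqAle; move: Iz; rewrite I01E => /andP[-> _]; rewrite andbT.
    apply/eqP => z0; apply: zA; exists 0 => //=.
    by rewrite mulr0 invr0.
  have Kc : K y z @[y --> x] --> K x z.
    apply: K_continuous => // xz; apply: zA; exists (Num.floor (x * z)^-1) => //=.
    by rewrite -xz -[RHS]mulr1; field; rewrite !gt_eqF.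
  have Kd : K (u n) z - K x z @[n --> \oo] --> K x z - K x z.
    by apply: cvgB; [exact: cvg_comp ux Kc|exact: cvg_cst].
  rewrite subrr in Kd; rewrite /f_ /cst.
  apply: cvg_EFin; first exact: nearW.
  by rewrite -[X in _ --> X](mulr0 0); exact: cvgM.
- exact: (bmeas_integrable (bmeas_cst 1)).
- apply: aeW => z n _; rewrite /f_ /= lee_fin normrM.
  by rewrite mulr_ile1// normKB_le.
by move=> _ _.
Qed.

Lemma near_dK x (e : R) : 0 < x -> 0 < e -> \forall y \near x, dK y x < e.
Proof.
move=> x0 e0.
have /cvgrPdist_lt/(_ e e0) : dK y x @[y --> x] --> (0 : R).
  by apply/(@cvg_nbhsP _ R^o) => u ux; exact: dK_cvg.
by apply: filterS => y; rewrite sub0r normrN ger0_norm// dK_ge0.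
Qed.

Definition KLip (C : R) f :=
  forall x y, I x -> I y -> `|f x - f y| <= C * dK x y.

Lemma KLip_continuous C f : 0 <= C -> KLip C f ->
  {within `]0, 1], continuous f}.
Proof.
move=> C0 fC; apply/subspace_continuousP => x /=; rewrite in_itv /= => /andP[x0 x1].
apply/cvgrPdist_lt => e e0; rewrite near_withinE.
(* The divisor is [C + 1] since [C] may be 0. *)
have e0' : 0 < e / (C + 1) by rewrite divr_gt0// ltr_wpDl.
near=> y => /=; rewrite in_itv /= => /andP[y0 y1].
rewrite distrC; apply: le_lt_trans (fC _ _ _ _) _; rewrite ?I01E ?(ltW y0) ?(ltW x0)//=.
apply: (@le_lt_trans _ _ ((C + 1) * dK y x)).
  by rewrite ler_wpM2r ?dK_ge0// lerDl.
rewrite mulrC -ltr_pdivlMr ?ltr_wpDl//; near: y.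
exact: near_dK.
Unshelve. all: by end_near. Qed.

Lemma KLip_bound C f x : 0 <= C -> KLip C f -> I x -> `|f x| <= `|f 0| + C.
Proof.
move=> C0 fC Ix; have -> : f x = f 0 + (f x - f 0) by ring.
apply: le_trans (ler_normD _ _) _; rewrite lerD2l.
apply: le_trans (fC _ _ Ix _) _; first by rewrite I01E lexx ler01.
by rewrite ler_piMr// dK_le1.
Qed.

(** Continuity is known on ]0,1] only, but adding one endpoint does not affect measurability, and
    [KLip_bound] covers 0. *)
Lemma KLip_bmeas C f : 0 <= C -> KLip C f -> bmeas f.
Proof.
move=> C0 fC; split; last by exists (`|f 0| + C) => x; exact: KLip_bound.
suff : measurable_fun (`]0, 1]%classic : set R) f.
  by move/measurable_fun_itv_obnd_cbndP.
apply: subspace_continuous_measurable_fun; first exact: measurable_itv.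
exact: KLip_continuous fC.
Qed.

(** Equicontinuity spreads smallness of [u i] at a point to a neighbourhood of it, and by
    compactness finitely many such neighbourhoods cover [d,1]. The filter is arbitrary so that
    ultrafilters and ordinary sequences are both covered. *)
Lemma KLip_uniform (J : Type) (F : set_system J) (u : J -> R -> R) C :
  Filter F -> 0 <= C -> (forall i, KLip C (u i)) ->
  (forall x, I x -> u i x @[i --> F] --> (0 : R)) ->
  forall d e, 0 < d -> 0 < e ->
  \forall i \near F, forall x, d <= x <= 1 -> `|u i x| < e.
Proof.
move=> FF C0 uC u0 d e d0 e0.
have /compact_near_coveringP/near_covering_withinP cov := @segment_compact R d 1.
suff : \forall i \near F, `[d, 1] `<=` (fun x => `|u i x| < e).
  by apply: filterS => i ui x dx; apply: ui; rewrite /= in_itv.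
apply: cov => x /=; rewrite in_itv /= => /andP[dx x1].
have x0 : 0 < x by exact: lt_le_trans dx.
have e0' : 0 < e / 2 / (C + 1) by rewrite !divr_gt0// ltr_wpDl.
have Ix : I x by rewrite I01E (ltW x0).
exists ([set y | dK y x < e / 2 / (C + 1)], [set i | `|u i x| < e / 2]) => /=.
  split; first exact: near_dK.
  have /cvgrPdist_lt/(_ (e / 2)) := u0 _ Ix.
  rewrite divr_gt0// => /(_ isT); apply: filterS => i.
  by rewrite sub0r normrN.
move=> [y i] /= [yx uix]; rewrite in_itv /= => /andP[dy y1].
have -> : u i y = (u i y - u i x) + u i x by ring.
rewrite (splitr e); apply: le_lt_trans (ler_normD _ _) _; apply: ltrD => //.
apply: le_lt_trans (uC _ _ _ _ _) _ => //.
  by rewrite I01E y1 andbT (le_trans _ dy)// ltW.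
apply: (@le_lt_trans _ _ ((C + 1) * dK y x)).
  by rewrite ler_wpM2r ?dK_ge0// lerDl.
by rewrite mulrC -ltr_pdivlMr ?ltr_wpDl.
Qed.

(** The integral is split at a small [d]: on [d,1] the [u i] are uniformly small, and on [0,d] they
    are eventually bounded by [C + 1] while the interval is short. *)
Lemma KLip_inner_cvg0 (J : Type) (F : set_system J) (u h : J -> R -> R) C M0 :
  Filter F -> 0 <= C -> (forall i, KLip C (u i)) ->
  (forall x, I x -> u i x @[i --> F] --> (0 : R)) ->
  (forall i, bmeas (h i)) -> (forall i x, I x -> `|h i x| <= M0) ->
  inner (u i) (h i) @[i --> F] --> (0 : R).
Proof.
move=> FF C0 uC u0 bh hM0; apply/cvgrPdist_lt => e e0.
pose M := `|M0| + 1.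
have M_gt0 : 0 < M by rewrite /M ltr_wpDl.
have hM i x : I x -> `|h i x| <= M.
  by move=> Ix; rewrite (le_trans (hM0 _ _ Ix))// /M (le_trans (ler_norm _))// lerDl.
have C1 : 0 < C + 1 by rewrite ltr_wpDl.
(* [eta] and [d] are chosen so that [M * (eta + (C + 1) * d)] is at most [2 * M * eta], which is
   [e / 2]. *)
pose eta := e / (4 * M).
have eta0 : 0 < eta by rewrite /eta divr_gt0// mulr_gt0.
pose d := Num.min 1 (eta / (C + 1)).
have d0 : 0 < d by rewrite /d lt_min ltr01 divr_gt0.
have d1 : d <= 1 by rewrite /d ge_min lexx.
have dC : (C + 1) * d <= eta.
  by rewrite mulrC -ler_pdivlMr// /d ge_min lexx orbT.
have I0 : I 0 by rewrite I01E lexx ler01.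
have mdI : measurable (`[0, d]%classic : set R) by exact: measurable_itv.
near=> i.
have ui0 : `|u i 0| < 1.
  near: i; have /cvgrPdist_lt/(_ 1 ltr01) := u0 _ I0.
  by apply: filterS => i; rewrite sub0r normrN.
have uid x : d <= x <= 1 -> `|u i x| < eta.
  by move: x; near: i; exact: KLip_uniform uC u0 _ _ d0 eta0.
have bu : bmeas (u i) by exact: KLip_bmeas (uC i).
have bone := bmeas_indic mdI.
rewrite sub0r normrN; apply: le_lt_trans (le_norm_int01 (bmeasM bu (bh i))) _.
pose G x := M * (eta + (C + 1) * \1_(`[0, d]%classic : set R) x).
have bG : bmeas G.
  by apply: bmeasZ; apply: bmeasD; [exact: bmeas_cst|exact: bmeasZ].
apply: (@le_lt_trans _ _ (int01 G)).
  apply: le_int01 => //; first by apply: bmeas_norm; exact: bmeasM.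
  move=> x Ix; rewrite normrM mulrC /G ler_pM// ?hM//.
  have [dx|xd] := leP d x.
    apply: (@le_trans _ _ eta); last by rewrite lerDl mulr_ge0// ?ltW// indicE.
    by rewrite ltW// uid// dx; move: Ix; rewrite I01E => /andP[].
  rewrite indicE mem_set; last first.
    by rewrite /= in_itv /= (ltW xd) andbT; move: Ix; rewrite I01E => /andP[].
  rewrite mulr1 (le_trans (KLip_bound C0 (uC i) Ix))//.
  by have := ui0; have := eta0; lra.
rewrite /G int01Z; last by apply: bmeasD; [exact: bmeas_cst|exact: bmeasZ].
rewrite int01D; [|exact: bmeas_cst|exact: bmeasZ].
rewrite int01_cst int01Z// int01_indic//; last first.
  by move=> x /=; rewrite I01E in_itv /= => /andP[-> /le_trans]; apply.
rewrite lebesgue_measure_itv /= lte_fin d0 oppr0 adde0 /=.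
apply: (@le_lt_trans _ _ (M * (eta + eta))).
  by rewrite ler_wpM2l ?(ltW M_gt0)// lerD2l.
have -> : M * (eta + eta) = e / 2 by rewrite /eta; field; rewrite gt_eqF.
by rewrite ltr_pdivrMr// ltr_pMr// ltr1n.
Unshelve. all: by end_near. Qed.

(** If [f x] is nonzero at some [x > 0], continuity keeps |f| above half of |f x| on an interval,
    which makes the norm positive. The value at 0 is a separate hypothesis because continuity is
    available on ]0,1] only. *)
Lemma KLip_eq0 C f : 0 <= C -> KLip C f -> inner f f = 0 -> f 0 = 0 ->
  forall x, I x -> f x = 0.
Proof.
move=> C0 fC f0 f00 x Ix; apply: contrapT => fx0.
have /andP[x0 x1] : 0 < x <= 1.
  move: Ix; rewrite I01E => /andP[x0 ->]; rewrite andbT lt_neqAle x0 andbT.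
  by apply/eqP => x_eq0; apply: fx0; rewrite -x_eq0.
pose a := `|f x|.
have a0 : 0 < a by rewrite normr_gt0; exact/eqP.
have bf := KLip_bmeas C0 fC.
have [|r /= r0 rP] := @near_dK x (a / 2 / (C + 1)) x0.
  by rewrite !divr_gt0// ltr_wpDl.
(* The interval [s,x] lies to the left of [x], hence in [0,1] even when [x = 1]; [x / 2] keeps [s]
   positive and [r / 2] keeps the interval within the radius of [rP]. *)
pose s := Num.max (x / 2) (x - r / 2).
have s0 : 0 < s by rewrite /s lt_max divr_gt0.
have sx : s < x.
  by rewrite /s gt_max ltr_pdivrMr// ltr_pMr ?ltr1n//= ltrBlDr ltrDl divr_gt0.
pose S : set R := `[s, x]%classic.
have mS : measurable S by exact: measurable_itv.
have SI : S `<=` I.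
  move=> y; rewrite /S /= I01E in_itv /= => /andP[sy yx].
  by rewrite (le_trans (ltW s0) sy) (le_trans yx x1).
have bS := bmeas_indic mS.
suff : (a / 2) ^+ 2 * (x - s) <= 0.
  by apply/negP; rewrite -ltNge mulr_gt0 ?subr_gt0// exprn_gt0// divr_gt0.
rewrite -f0.
have -> : x - s = int01 \1_S.
  by rewrite int01_indic// lebesgue_measure_itv /= lte_fin sx.
rewrite -int01Z//; apply: le_int01; [exact: bmeasZ|exact: bmeasM|].
move=> y Iy; rewrite indicE; case: (boolP (y \in S)) => [|_]; last first.
  by rewrite mulr0 -expr2 sqr_ge0.
rewrite inE /S /= in_itv /= mulr1 => /andP[sy yx].
rewrite -expr2 -[f y ^+ 2]real_normK ?num_real//.
rewrite ler_pXn2r ?nnegrE ?divr_ge0 ?normr_ge0 ?(ltW a0)//.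
have yr : dK y x < a / 2 / (C + 1).
  apply: rP => /=; rewrite ger0_norm ?subr_ge0//.
  have : x - r / 2 <= y by apply: le_trans sy; rewrite /s le_max lexx orbT.
  lra.
have : `|f y - f x| <= a / 2.
  apply: le_trans (fC _ _ Iy Ix) _.
  apply: (@le_trans _ _ ((C + 1) * dK y x)).
    by rewrite ler_wpM2r ?dK_ge0// lerDl.
  by rewrite mulrC -ler_pdivlMr ?ltr_wpDl// ltW.
have := lerB_dist (f x) (f y); rewrite -/a distrC; lra.
Qed.

(** This is Cauchy-Schwarz. The constant depends only on the norm of [f], so the image of the unit
    ball is equicontinuous on ]0,1]. *)
Lemma Kop_KLip f : bmeas f -> KLip (norm2 f) (Kop f).
Proof.
move=> bf x y _ _; rewrite /Kop -[int01 _]/(inner (K x) f) -[int01 _]/(inner (K y) f).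
rewrite -innerBl//; try exact: bmeas_K.
by rewrite mulrC le_norm_inner//; exact: bmeas_KB.
Qed.

Lemma bmeas_Kop f : bmeas f -> bmeas (Kop f).
Proof.
by move=> bf; apply: KLip_bmeas (Kop_KLip bf); exact: norm2_ge0.
Qed.

End KernelContinuity.


(** The image of an ultrafilter is an ultrafilter, and this one contains the compact [-M,M]. *)
Lemma ultra_bounded_cvg (R : realType) (J : Type) (U : set_system J) (v : J -> R)
    (M : R) : UltraFilter U -> (forall i, `|v i| <= M) ->
  exists l : R, v i @[i --> U] --> l.
Proof.
move=> UU vM; have PU := @ultra_proper _ _ UU.
have ultra_v : UltraFilter (v i @[i --> U]).
  split; first exact: fmap_proper_filter.
  move=> G PG vG; apply/seteqP; split => A; last exact: vG.
  move=> GA; have [//|UnA] := in_ultra_setVsetC (v @^-1` A) UU.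
  have GnA : G (~` A) by apply: vG.
  have : G (A `&` ~` A) by exact: filterI.
  by rewrite setICr => /(@filter_not_empty _ _ PG).
have := @segment_compact R (- M) M; rewrite compact_ultra => /(_ _ ultra_v).
case=> [|l [_ vl]]; last by exists l.
by apply: nearW => i /=; rewrite in_itv /= -ler_norml vM.
Qed.

(** * Linearity, norm bounds and limits for the operator *)

Section IntegralOperator.
Context {R : realType}.
Implicit Types (f g h : R -> R) (x y z : R).
Local Notation I := (@I01 R).

Lemma eq_Kop f g x : (forall y, I y -> f y = g y) -> Kop f x = Kop g x.
Proof. by move=> fg; apply: eq_int01 => y Iy; rewrite fg. Qed.

Lemma KopE f x : Kop f x = inner (K x) f. Proof. by []. Qed.

Lemma KopB f g x : bmeas f -> bmeas g ->
  Kop (fun y => f y - g y) x = Kop f x - Kop g x.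
Proof. by move=> bf bg; rewrite !KopE innerBr//; exact: bmeas_K. Qed.

Lemma KopD f g x : bmeas f -> bmeas g ->
  Kop (fun y => f y + g y) x = Kop f x + Kop g x.
Proof. by move=> bf bg; rewrite !KopE innerDr//; exact: bmeas_K. Qed.

Lemma KopZ (c : R) f x : bmeas f -> Kop (fun y => c * f y) x = c * Kop f x.
Proof. by move=> bf; rewrite !KopE innerZr//; exact: bmeas_K. Qed.

Lemma Kop_at0 f : Kop f 0 = 0.
Proof.
by rewrite /Kop -[RHS](int01_cst 0); apply: eq_int01 => y _; rewrite K0l mul0r.
Qed.

Lemma norm2_K_le1 x : norm2 (K x) <= 1.
Proof.
apply: norm2_le => //; rewrite expr1n -[leRHS](int01_cst 1).
apply: le_int01; [by apply: bmeasM; exact: bmeas_K|exact: bmeas_cst|].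
move=> z _; rewrite -expr2 -real_normK ?num_real// expr_le1//.
by apply: le_trans (normK_le x z) _; lra.
Qed.

Lemma normKop_le f x : bmeas f -> `|Kop f x| <= norm2 f.
Proof.
move=> bf; rewrite KopE; apply: le_trans (le_norm_inner (bmeas_K x) bf) _.
by rewrite ler_piMl ?norm2_ge0// norm2_K_le1.
Qed.

Lemma Kop_norm0 f x : bmeas f -> inner f f = 0 -> Kop f x = 0.
Proof.
move=> bf f0; apply/eqP; rewrite -normr_le0; apply: le_trans (normKop_le x bf) _.
by rewrite /norm2 f0 sqrtr0.
Qed.

Lemma inner_KopKop_le f : bmeas f -> inner (Kop f) (Kop f) <= inner f f.
Proof.
move=> bf; rewrite -[leRHS]int01_cst; apply: le_int01.
- by apply: bmeasM; exact: bmeas_Kop.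
- exact: bmeas_cst.
move=> x _; rewrite -expr2 -real_normK ?num_real// -sqr_norm2.
by rewrite ler_pXn2r ?nnegrE ?norm2_ge0// normKop_le.
Qed.

Lemma Kop_KLip1 f : bmeas f -> inner f f <= 1 -> KLip 1 (Kop f).
Proof.
move=> bf f1 x y Ix Iy; apply: le_trans (Kop_KLip bf Ix Iy) _.
by rewrite ler_wpM2r ?dK_ge0// norm2_le// expr1n.
Qed.

Lemma KLipB C C' f g : KLip C f -> KLip C' g -> KLip (C + C') (fun x => f x - g x).
Proof.
move=> fC gC x y Ix Iy.
have -> : f x - g x - (f y - g y) = (f x - f y) - (g x - g y) by ring.
by apply: le_trans (ler_normB _ _) _; rewrite mulrDl lerD ?fC ?gC.
Qed.

Lemma KLip_lim (F : set_system nat) (u : nat -> R -> R) g C :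
  ProperFilter F -> (forall i, KLip C (u i)) ->
  (forall x, I x -> u i x @[i --> F] --> g x) -> KLip C g.
Proof.
move=> PF uC ug x y Ix Iy.
have l1 : `|u i x - u i y| @[i --> F] --> `|g x - g y|.
  by apply: cvg_norm; apply: cvgB; exact: ug.
have l2 : C * dK x y @[i --> F] --> C * dK x y by exact: cvg_cst.
by apply: (ler_cvg_to l1 l2); apply: nearW => i; exact: uC.
Qed.

End IntegralOperator.

(** * Variational construction of an eigenfunction orthogonal to the system *)

Section TopEigenfunction.
Context {R : realType} (phi : nat -> R -> R) (lam : nat -> R).
Local Notation I := (@I01 R).
Implicit Types (f g h : R -> R).
Hypothesis bphi : forall j, bmeas (phi j).
Hypothesis Kphi : forall j x, I x -> Kop (phi j) x = (lam j)^-1 * phi j x.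

Definition orth f := forall j, inner f (phi j) = 0.

Lemma orthZ (c : R) f : bmeas f -> orth f -> orth (fun x => c * f x).
Proof. by move=> bf of_ j; rewrite innerZl// of_ mulr0. Qed.

Lemma orthD f g : bmeas f -> bmeas g -> orth f -> orth g ->
  orth (fun x => f x + g x).
Proof. by move=> bf bg of_ og j; rewrite innerDl// of_ og addr0. Qed.

Lemma inner_Kop_phi f j : bmeas f ->
  inner (Kop f) (phi j) = (lam j)^-1 * inner f (phi j).
Proof.
move=> bf; rewrite -inner_Kop// -innerZr//.
by apply: eq_inner => // x Ix; rewrite Kphi.
Qed.

Lemma orth_Kop f : bmeas f -> orth f -> orth (Kop f).
Proof. by move=> bf of_ j; rewrite inner_Kop_phi// of_ mulr0. Qed.

(** Its supremum is the squared operator norm of [Kop] on the bounded measurable functions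
    orthogonal to every [phi j]. *)
Definition rayleigh : set R := [set r | exists f,
  [/\ bmeas f, orth f, inner f f <= 1 & r = inner (Kop f) (Kop f)]].

Lemma has_ubound_rayleigh : has_ubound rayleigh.
Proof.
by exists 1 => r [f [bf _ f1 ->]]; exact: le_trans (inner_KopKop_le bf) _.
Qed.

Lemma rayleigh_le f : bmeas f -> orth f ->
  inner (Kop f) (Kop f) <= sup rayleigh * inner f f.
Proof.
move=> bf of_; have := inner_ge0 f; rewrite le_eqVlt => /predU1P[f0|f0].
  rewrite -f0 mulr0 -[leRHS](int01_cst 0) le_eqVlt; apply/orP; left; apply/eqP.
  by apply: eq_int01 => x _; rewrite Kop_norm0// mulr0.
pose c := (norm2 f)^-1.
have c2 : c ^+ 2 = (inner f f)^-1 by rewrite /c exprVn sqr_norm2.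
rewrite -ler_pdivrMr// mulrC -c2; apply: ub_le_sup; first exact: has_ubound_rayleigh.
exists (fun x => c * f x); split.
- exact: bmeasZ.
- exact: orthZ.
- by rewrite innerZl ?innerZr//; [rewrite mulrA -expr2 c2 mulVf// gt_eqF|exact: bmeasZ].
have bK := bmeas_Kop bf.
rewrite expr2 -mulrA -innerZr// -innerZl//; last exact: bmeasZ.
by apply: eq_inner => x _; rewrite KopZ.
Qed.

(** With T for [Kop] and m for the supremum, ||T^2 f - m f||^2 expands to ||T^2 f||^2 - 2 m ||T
    f||^2 + m^2 ||f||^2, and the first term is at most m ||T f||^2 because T f is again orthogonal
    to the system. Hence maximizing sequences are approximate eigenvectors of T^2. *)
Lemma defect_le f : bmeas f -> orth f -> inner f f <= 1 ->
  inner (fun x => Kop (Kop f) x - sup rayleigh * f x)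
        (fun x => Kop (Kop f) x - sup rayleigh * f x) <=
  sup rayleigh * (sup rayleigh - inner (Kop f) (Kop f)).
Proof.
move=> bf of_ f1; set m := sup rayleigh.
have bK := bmeas_Kop bf; have bKK := bmeas_Kop bK; have bmf := bmeasZ m bf.
have bh := bmeasB bKK bmf.
rewrite innerBl// !innerBr// !innerZl// !innerZr//.
rewrite (inner_Kop bf bK) (innerC (Kop (Kop f)) f) (inner_Kop bf bK).
have := rayleigh_le bK (orth_Kop bf of_); rewrite -/m.
have m0 : 0 <= m.
  apply: le_trans (inner_ge0 (Kop f)) _; apply: ub_le_sup => //.
    exact: has_ubound_rayleigh.
  by exists f.
have := ler_wpM2l (mulr_ge0 m0 m0) f1; lra.
Qed.

Lemma exists_Kop2_eigenfunction f0 : bmeas f0 -> orth f0 ->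
  0 < inner (Kop f0) (Kop f0) ->
  exists g m, [/\ bmeas g, orth g, 0 < m, 0 < inner g g &
    forall x, I x -> Kop (Kop g) x = m * g x].
Proof.
move=> bf0 of0 Kf0; set m := sup rayleigh.
have m0 : 0 < m.
  rewrite ltNge; apply/negP => m_le0; have := rayleigh_le bf0 of0.
  rewrite leNgt => /negP; apply; apply: le_lt_trans _ Kf0.
  by rewrite mulr_le0_ge0// inner_ge0.
have Rsup : has_sup rayleigh.
  split; last exact: has_ubound_rayleigh.
  exists 0, (fun=> 0); split.
  - exact: bmeas_cst.
  - by move=> j; rewrite -[RHS](int01_cst 0); apply: eq_int01 => x _; rewrite /= mul0r.
  - rewrite (_ : inner _ _ = 0) ?ler01// -[RHS](int01_cst 0).
    by apply: eq_int01 => x _; rewrite /= mul0r.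
  rewrite -[LHS](int01_cst 0); apply: eq_int01 => x _; rewrite Kop_norm0 ?mulr0//.
    exact: bmeas_cst.
  by rewrite -[RHS](int01_cst 0); apply: eq_int01 => y _; rewrite /= mul0r.
have /choice[f fP] : forall n : nat, exists f, [/\ bmeas f, orth f,
    inner f f <= 1 & m - n.+1%:R^-1 < inner (Kop f) (Kop f)].
  move=> n; have n0 : 0 < n.+1%:R^-1 :> R by rewrite invr_gt0.
  have [_ [f [bf of_ f1 ->]] mf] := sup_adherent n0 Rsup.
  by exists f.
have bf n : bmeas (f n) by case: (fP n).
have of_ n : orth (f n) by case: (fP n).
have f1 n : inner (f n) (f n) <= 1 by case: (fP n).
have mf n : m - n.+1%:R^-1 < inner (Kop (f n)) (Kop (f n)) by case: (fP n).
(* An ultrafilter finer than convergence at infinity gives limits at all points [x] at once, with no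
   subsequence to extract. *)
have [U [UU oU]] := ultraFilterLemma (@eventually_filter).
have PU := @ultra_proper _ _ UU.
have toU (u : nat -> R) l : u n @[n --> \oo] --> l -> u n @[n --> U] --> l.
  by move=> ul A /ul; exact: oU.
have inv0 : n.+1%:R^-1 @[n --> U] --> (0 : R).
  by apply: toU; exact: cvg_harmonic.
have bK n := bmeas_Kop (bf n); have bKK n := bmeas_Kop (bK n).
have Kf1 n x : `|Kop (f n) x| <= 1.
  by apply: le_trans (normKop_le x (bf n)) _; rewrite norm2_le// expr1n.
have /choice[g Kfg] : forall x : R, exists l : R, Kop (f n) x @[n --> U] --> l.
  by move=> x; apply: (ultra_bounded_cvg (M := 1)).
have KfL n : KLip 1 (Kop (f n)) by exact: Kop_KLip1.
have gL : KLip 1 g by apply: (KLip_lim PU KfL) => x _; exact: Kfg.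
have bg : bmeas g by exact: KLip_bmeas gL.
pose w n x := Kop (f n) x - g x.
have bw n : bmeas (w n) by exact: bmeasB.
have wL n : KLip (1 + 1) (w n) by exact: KLipB.
have w0 x : I x -> w n x @[n --> U] --> (0 : R).
  by move=> _; rewrite -(subrr (g x)); apply: cvgB => //; exact: cvg_cst.
have w_inner h : bmeas h -> inner (w n) h @[n --> U] --> (0 : R).
  move=> bh; have [_ [M hM]] := bh.
  by apply: (KLip_inner_cvg0 (M0 := M) _ _ wL w0).
(* The squared norms of [Kop (f n)] tend to [m] by the choice of [f n], and to <g,g> since [w n]
   tends to 0 against bounded families. *)
have gg : inner g g = m.
  have l1 : inner (Kop (f n)) (Kop (f n)) @[n --> U] --> m.
    apply: (@squeeze_cvgr _ _ _ _ (fun n => m - n.+1%:R^-1) (fun=> m)).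
    - apply: nearW => n; rewrite (ltW (mf n)) /=.
      by apply: ub_le_sup; [exact: has_ubound_rayleigh|exists (f n)].
    - by rewrite -[X in _ --> X]subr0; apply: cvgB => //; exact: cvg_cst.
    - exact: cvg_cst.
  have l2 : inner (Kop (f n)) (Kop (f n)) @[n --> U] --> inner g g.
    rewrite (_ : (fun n => _) = (fun n => inner (w n) (Kop (f n)) +
      (inner (w n) g + inner g g))); last first.
      apply/funext => n; rewrite /w !innerBl// (innerC g (Kop (f n))); ring.
    rewrite -[X in _ --> X]add0r; apply: cvgD.
      by apply: (KLip_inner_cvg0 (M0 := 1) _ _ wL w0).
    by rewrite -[X in _ --> X]add0r; apply: cvgD; [exact: w_inner|exact: cvg_cst].
  exact: (cvg_unique _ l2 l1).
exists g, m; split => //; last 2 first.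
- by rewrite gg.
- move=> x Ix.
  (* T^3 f_n(x) has two limits: T^2 g(x), as T^2 w_n(x) = <w_n, T K(x,.)> tends to 0, and m g(x), as
     the defect [h n] has norm at most sqrt(m/(n+1)). *)
  have l1 : Kop (Kop (Kop (f n))) x @[n --> U] --> Kop (Kop g) x.
    rewrite (_ : (fun n => _) = (fun n => inner (w n) (Kop (K x)) + Kop (Kop g) x)).
      rewrite -[X in _ --> X]add0r; apply: cvgD; last exact: cvg_cst.
      by apply: w_inner; apply: bmeas_Kop; exact: bmeas_K.
    apply/funext => n; rewrite inner_Kop//; last exact: bmeas_K.
    rewrite innerC -KopE.
    rewrite (@eq_Kop _ (Kop (w n)) (fun y => Kop (Kop (f n)) y - Kop g y)); last first.
      by move=> y _; exact: (KopB y (bK n) bg).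
    have bKg := bmeas_Kop bg.
    by rewrite KopB// subrK.
  have l2 : Kop (Kop (Kop (f n))) x @[n --> U] --> m * g x.
    pose h n y := Kop (Kop (f n)) y - m * f n y.
    have bh n : bmeas (h n) by apply: bmeasB => //; exact: bmeasZ.
    rewrite (_ : (fun n => _) = (fun n => Kop (h n) x + m * Kop (f n) x)); last first.
      apply/funext => n; rewrite (KopB x (bKK n) (bmeasZ m (bf n))) KopZ//.
      by rewrite subrK.
    rewrite -[X in _ --> X]add0r; apply: cvgD; last first.
      by apply: cvgM => //; exact: cvg_cst.
    apply: norm_cvg0.
    have s0 : Num.sqrt (m * n.+1%:R^-1) @[n --> U] --> (0 : R).
      have s1 : m * n.+1%:R^-1 @[n --> U] --> (0 : R).
        by rewrite -[X in _ --> X](mulr0 m); apply: cvgM => //; exact: cvg_cst.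
      rewrite -[X in _ --> X]sqrtr0; apply: (cvg_comp _ _ s1).
      exact: sqrt_continuous.
    apply: (@squeeze_cvgr _ _ _ _ (fun=> 0) (fun n : nat => Num.sqrt (m * n.+1%:R^-1))) => //.
      apply: nearW => n; rewrite normr_ge0 /=; apply: le_trans (normKop_le x (bh n)) _.
      rewrite /norm2 ler_sqrt ?mulr_ge0 ?invr_ge0 ?(ltW m0)//.
      apply: le_trans (defect_le (bf n) (of_ n) (f1 n)) _.
      by rewrite -/m ler_wpM2l ?(ltW m0)// lerBlDl -lerBlDr ltW// mf.
    exact: cvg_cst.
  exact: (cvg_unique _ l1 l2).
(* Every [Kop (f n)] is orthogonal to [phi j], so the constant -<g, phi_j> has limit 0. *)
- move=> j; have := w_inner _ (bphi j).
  rewrite (_ : (fun n => _) = (fun=> - inner g (phi j))); last first.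
    by apply/funext => n; rewrite /w innerBl// (orth_Kop (bf n) (of_ n)) sub0r.
  move=> l1; have l2 : - inner g (phi j) @[n --> U] --> - inner g (phi j).
    exact: cvg_cst.
  by apply/eqP; rewrite -oppr_eq0; apply/eqP; exact: (cvg_unique _ l2 l1).
Qed.

(** With s = sqrt m, T^2 - m factors as (T - s)(T + s). So [u = (T + s) g] satisfies T u = s u and
    is an eigenfunction unless its norm is 0, in which case T g = -s g. Eigenvalues here are the
    reciprocals of s and -s. *)
Lemma exists_orth_eigenfunction f : bmeas f -> orth f ->
  0 < inner (Kop f) (Kop f) ->
  exists psi mu, eigenfunction psi mu /\ orth psi.
Proof.
move=> bf of_ /(exists_Kop2_eigenfunction bf of_)[g [m [bg og m0 g0 KKg]]].
pose s := Num.sqrt m.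
have s0 : 0 < s by rewrite sqrtr_gt0.
have ss : s * s = m by rewrite -expr2 sqr_sqrtr// ltW.
have bKg := bmeas_Kop bg; have bsg := bmeasZ s bg.
pose u x := Kop g x + s * g x.
have bu : bmeas u by exact: bmeasD.
have Ku x : I x -> Kop u x = s * u x.
  by move=> Ix; rewrite /u KopD// KopZ// KKg// -ss; ring.
have := inner_ge0 u; rewrite le_eqVlt => /predU1P[u0|u0].
  exists g, (- s^-1); split=> //; split; first exact: bmeas_L2.
  split; first by rewrite /norm2 sqrtr_gt0.
  move=> x; rewrite inE => Ix; rewrite -/(Kop g x).
  (* Norm 0 gives [Kop u x = 0] at every point, so [u] vanishes everywhere on [0,1], not just almost
     everywhere. *)
  have /eqP : s * u x = 0 by rewrite -Ku// Kop_norm0.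
  rewrite mulf_eq0 gt_eqF//= /u addr_eq0 => /eqP ->.
  by rewrite mulrNN mulrA mulVf ?mul1r// gt_eqF.
exists u, s^-1; split.
  split; first exact: bmeas_L2.
  split; first by rewrite /norm2 sqrtr_gt0.
  by move=> x; rewrite inE => Ix; rewrite -/(Kop u x) Ku// mulrA mulVf ?mul1r// gt_eqF.
by apply: orthD => //; [exact: orth_Kop|exact: orthZ].
Qed.

End TopEigenfunction.


(** * Residual kernels and convergence of the bilinear series *)

Section EigenSystem.
Context {R : realType}.
Local Notation mu := (@lebesgue_measure R).
Local Notation I := (@I01 R).
Implicit Types (f g : R -> R) (x y z : R).

(** The eigenvalue equation holds at every point of [0,1], and |K psi| <= 1 + psi^2, so |psi| is at
    most |c| times the integral of 1 + psi^2. This brings L^2 eigenfunctions into the bounded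
    class. *)
Lemma eigenfunction_bmeas psi (c : R) : eigenfunction psi c -> bmeas psi.
Proof.
case=> -[mpsi psi2] [_ psiE]; split => //.
have mI := @measurable_I01 R.
have i2 : mu.-integrable I (EFin \o (fun y => psi y ^+ 2)).
  apply/integrableP; split.
    by apply/measurable_EFinP; exact: measurable_funX.
  apply: le_lt_trans psi2; rewrite le_eqVlt; apply/orP; left; apply/eqP.
  by apply: eq_integral => y _; rewrite /= ger0_norm// sqr_ge0.
have i1 : mu.-integrable I (EFin \o (fun y => 1 + psi y ^+ 2)).
  have i0 : mu.-integrable I (EFin \o (fun=> 1)).
    exact: (bmeas_integrable (bmeas_cst (1 : R))).
  exact: (integrableD _ i0 i2).
exists (`|c| * int01 (fun y => 1 + psi y ^+ 2)) => x Ix.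
rewrite psiE ?inE// normrM ler_wpM2l//.
have [mK _] := bmeas_K x.
have KP y : `|K x y * psi y| <= 1 + psi y ^+ 2.
  rewrite normrM -[psi y ^+ 2]real_normK ?num_real//.
  have := normK_le x y; have := normr_ge0 (K x y); have := normr_ge0 (psi y).
  set a := `|K x y|; set b := `|psi y| => b0 a0 a1.
  by have := sqr_ge0 (b - 1); nra.
have iK : mu.-integrable I (EFin \o (fun y => K x y * psi y)).
  apply: (le_integrable _ _ _ i1) => //.
    by apply/measurable_EFinP; exact: measurable_funM.
  move=> y _; rewrite /= lee_fin; apply: le_trans (KP y) _; exact: ler_norm.
apply: le_trans (le_normr_Rintegral _ iK) _ => //.
rewrite /int01; apply: le_Rintegral => //.
exact: (integrable_norm iK).
Qed.

Context (phi : nat -> R -> R) (lam : nat -> R).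
Hypothesis sys : eigen_system phi lam.

Lemma eigen_neq0 j : lam j != 0.
Proof. by case: sys => /(_ j)[]. Qed.

Lemma bmeas_eigen j : bmeas (phi j).
Proof. by case: sys => /(_ j)[_ /eigenfunction_bmeas]. Qed.

Lemma Kop_eigen j x : I x -> Kop (phi j) x = (lam j)^-1 * phi j x.
Proof.
move=> Ix; case: sys => /(_ j)[lam0 [_ [_ phiE]]] _.
by rewrite phiE ?inE// mulrA mulVf// mul1r.
Qed.

Lemma inner_eigen i j : inner (phi i) (phi j) = (i == j)%:R.
Proof. by case: sys => _ []. Qed.

(** Otherwise some eigenfunction would be orthogonal to every [phi j], against maximality. *)
Lemma Kop_orth_eq0 f : bmeas f -> orth phi f -> inner (Kop f) (Kop f) = 0.
Proof.
move=> bf of_; have := inner_ge0 (Kop f); rewrite le_eqVlt => /predU1P[//|Kf0].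
have [psi [c [psiE opsi]]] := exists_orth_eigenfunction bmeas_eigen Kop_eigen bf of_ Kf0.
by case: sys => _ [_ [/(_ _ _ psiE)]].
Qed.

Definition term x y j := phi j x * phi j y / lam j ^+ 2.

(** For [y] in [0,1] the coefficient of [K y] along [phi j] is [Kop (phi j) y], that is
    [phi j y / lam j]. *)
Definition Kres n y z := K y z - \sum_(j < n) phi j y / lam j * phi j z.

Lemma bmeas_Kres n y : bmeas (Kres n y).
Proof.
apply: bmeasB; first exact: bmeas_K.
apply: (@bmeas_sum _ _ (fun j z => phi j y / lam j * phi j z)) => j.
by apply: bmeasZ; exact: bmeas_eigen.
Qed.

Lemma inner_Kres n y g : bmeas g -> inner g (Kres n y) =
  inner g (K y) - \sum_(j < n) phi j y / lam j * inner g (phi j).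
Proof.
move=> bg; have bF j : bmeas (fun z => phi j y / lam j * phi j z).
  by apply: bmeasZ; exact: bmeas_eigen.
rewrite innerBr//; [|exact: bmeas_K|exact: (bmeas_sum _ bF)].
rewrite (inner_sumr _ bF bg); congr (_ - _); apply: eq_bigr => j _.
by rewrite innerZr//; exact: bmeas_eigen.
Qed.

Lemma inner_Kres_eigen n y j : I y -> (j < n)%N -> inner (Kres n y) (phi j) = 0.
Proof.
move=> Iy jn; rewrite innerC inner_Kres; last exact: bmeas_eigen.
rewrite (bigD1 (Ordinal jn)) //= big1 ?addr0; last first.
  move=> i ij; rewrite inner_eigen.
  by rewrite [(j == i)%N]eq_sym (negbTE (ij : (i != j :> nat)%N)) mulr0.
by rewrite inner_eigen eqxx mulr1 innerC -KopE Kop_eigen// mulrC subrr.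
Qed.

Lemma Kop_Kres n x y : I y -> Kop (Kres n x) y = K2 x y - \sum_(j < n) term x y j.
Proof.
move=> Iy; rewrite KopE inner_Kres; last exact: bmeas_K.
congr (_ - _).
  by rewrite innerC; apply: eq_int01 => z _; rewrite [K z y]K_sym.
apply: eq_bigr => j _; rewrite -KopE Kop_eigen// /term.
by have := eigen_neq0 j => l0; field.
Qed.

(** What is subtracted from [K y] is a combination of the [phi j] with [j < n], all orthogonal to
    [Kres n x]. *)
Lemma inner_Kres_Kres n x y : I x -> I y ->
  inner (Kres n x) (Kres n y) = Kop (Kres n x) y.
Proof.
move=> Ix Iy; rewrite inner_Kres; last exact: bmeas_Kres.
rewrite big1 ?subr0 ?KopE 1?innerC// => j _.
by rewrite inner_Kres_eigen ?mulr0.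
Qed.

Lemma term_diag_ge0 x j : 0 <= term x x j.
Proof. by rewrite /term -expr2 divr_ge0 ?sqr_ge0. Qed.

Lemma K2_diag_le1 x : K2 x x <= 1.
Proof.
have -> : K2 x x = norm2 (K x) ^+ 2.
  by rewrite sqr_norm2; apply: eq_int01 => z _; rewrite [K z x]K_sym.
by rewrite expr_le1 ?norm2_ge0// norm2_K_le1.
Qed.

(** [term x x j] is the squared coefficient of [K x] along [phi j], and [K2 x x] minus the sum is
    the squared norm of the residual. *)
Lemma bessel n x : I x -> \sum_(j < n) term x x j <= 1.
Proof.
move=> Ix; have := inner_ge0 (Kres n x).
rewrite inner_Kres_Kres// Kop_Kres// subr_ge0 => /le_trans; apply.
exact: K2_diag_le1.
Qed.

Lemma inner_Kres_le1 n x : I x -> inner (Kres n x) (Kres n x) <= 1.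
Proof.
move=> Ix; rewrite inner_Kres_Kres// Kop_Kres//.
apply: le_trans (K2_diag_le1 x); rewrite gerBl.
by apply: sumr_ge0 => j _; exact: term_diag_ge0.
Qed.

(** By 2|ab| <= a^2 + b^2 the partial sums are at most the mean of two diagonal sums, each bounded
    by 1. *)
Lemma cvg_series_abs_term x y : I x -> I y ->
  cvg (series (fun j => `|term x y j|) @ \oo).
Proof.
move=> Ix Iy; apply: nondecreasing_is_cvgn.
  by apply: nondecreasing_series => j _ _; exact: normr_ge0.
exists 1 => _ [n _ <-]; rewrite /series /= big_mkord.
apply: (@le_trans _ _ (\sum_(j < n) (term x x j + term y y j) / 2)).
  apply: ler_sum => j _; rewrite /term; set b := (lam j ^+ 2)^-1.
  have b0 : 0 <= b by rewrite invr_ge0 sqr_ge0.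
  have -> : (phi j x * phi j x * b + phi j y * phi j y * b) / 2 =
    (phi j x * phi j x + phi j y * phi j y) / 2 * b by ring.
  rewrite normrM (ger0_norm b0) ler_wpM2r// ler_norml.
  have := sqr_ge0 (phi j x - phi j y); have := sqr_ge0 (phi j x + phi j y).
  by move=> ? ?; apply/andP; split; nra.
rewrite -mulr_suml big_split /= ler_pdivrMr// mul1r.
by have := bessel n Ix; have := bessel n Iy; lra.
Qed.

Lemma Kop_Kres_cvg0 x y : I x -> I y ->
  Kop (Kres n x) y @[n --> \oo] --> (0 : R).
Proof.
move=> Ix Iy; have bk n := bmeas_Kres n x; have bKk n := bmeas_Kop (bk n).
pose q z := lim (Kop (Kres n x) z @[n --> \oo]).
have qP z : I z -> Kop (Kres n x) z @[n --> \oo] --> q z.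
  move=> Iz.
  have st : cvg (series (term x z) @ \oo).
    exact/normed_cvg/cvg_series_abs_term.
  suff : cvg (Kop (Kres n x) z @[n --> \oo]) by [].
  rewrite (_ : (fun n => _) = (fun n => K2 x z - series (term x z) n)); last first.
    by apply/funext => n; rewrite Kop_Kres// /series /= big_mkord.
  by apply: is_cvgB => //; exact: is_cvg_cst.
have kL n : KLip 1 (Kop (Kres n x)) by apply: Kop_KLip1 => //; exact: inner_Kres_le1.
have qL : KLip 1 q by exact: (KLip_lim _ kL qP).
have bq : bmeas q by exact: KLip_bmeas qL.
pose w n z := Kop (Kres n x) z - q z.
have wL n : KLip (1 + 1) (w n) by exact: KLipB.
have w0 z : I z -> w n z @[n --> \oo] --> (0 : R).
  by move=> Iz; rewrite -(subrr (q z)); apply: cvgB; [exact: qP|exact: cvg_cst].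
have w_inner h : bmeas h -> inner (w n) h @[n --> \oo] --> (0 : R).
  move=> bh; have [_ [M hM]] := bh.
  by apply: (KLip_inner_cvg0 (M0 := M) _ _ wL w0).
(* [w n] tends to 0 against [h], so [q] inherits any orthogonality that holds for all large [n]. *)
have inner_q h : bmeas h -> (\forall n \near \oo, inner (Kop (Kres n x)) h = 0) ->
    inner q h = 0.
  move=> bh nh; have l1 := w_inner h bh.
  have l2 : inner (w n) h @[n --> \oo] --> - inner q h.
    apply: cvg_near_cst; apply: filterS nh => n nh.
    by rewrite /w innerBl// nh sub0r.
  by apply/eqP; rewrite -oppr_eq0; apply/eqP; exact: (cvg_unique _ l2 l1).
have oq : orth phi q.
  move=> j; apply: inner_q; first exact: bmeas_eigen.
  (* From this index on, [phi j] is among the functions projected out. *)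
  exists j.+1 => // n /= jn.
  by rewrite (inner_Kop_phi bmeas_eigen Kop_eigen)// inner_Kres_eigen// mulr0.
have Kq0 := Kop_orth_eq0 bq oq.
have qq : inner q q = 0.
  (* Self-adjointness turns <T k_n, q> into <k_n, T q>, which is 0 because T q has norm 0. *)
  apply: inner_q => //; apply: nearW => n; rewrite -inner_Kop//.
  apply/eqP; rewrite -normr_le0; apply: le_trans (le_norm_inner _ _) _ => //.
    exact: bmeas_Kop.
  by rewrite [norm2 (Kop q)]/norm2 Kq0 sqrtr0 mulr0.
(* [KLip_eq0] needs the value at 0, where every [Kop (Kres n x)] vanishes. *)
have q00 : q 0 = 0.
  have I0 : I 0 by rewrite I01E lexx ler01.
  have l2 : Kop (Kres n x) 0 @[n --> \oo] --> (0 : R).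
    by apply: cvg_near_cst; apply: nearW => n; exact: Kop_at0.
  exact: (cvg_unique _ (qP _ I0) l2).
by rewrite -(KLip_eq0 ler01 qL qq q00 Iy); exact: qP.
Qed.

(** One argument is changed at a time, by the symmetry of [Kop (Kres n x) y] in [x] and [y]; each
    change costs a constant 1 that does not depend on [n]. *)
Lemma Kres_diag_KLip n : KLip (1 + 1) (fun x => Kop (Kres n x) x).
Proof.
move=> x y Ix Iy.
have kL z : I z -> KLip 1 (Kop (Kres n z)).
  by move=> Iz; apply: Kop_KLip1; [exact: bmeas_Kres|exact: inner_Kres_le1].
have -> : Kop (Kres n x) x - Kop (Kres n y) y =
    (Kop (Kres n x) x - Kop (Kres n x) y) + (Kop (Kres n y) x - Kop (Kres n y) y).
  by rewrite -[Kop (Kres n x) y]inner_Kres_Kres// innerC inner_Kres_Kres//; ring.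
by rewrite (le_trans (ler_normD _ _))// mulrDl lerD// kL.
Qed.

(** Off the open square, some coordinate is 0, where the residual vanishes, or at least [eps], where
    the diagonal residual is uniformly small. *)
Lemma Kop_Kres_uniform (eps e : R) : 0 < eps -> 0 < e ->
  \forall n \near \oo, forall x y, I x -> I y ->
    ~ ((0 < x < eps) /\ (0 < y < eps)) -> `|Kop (Kres n x) y| < e.
Proof.
move=> eps0 e0.
have e20 : 0 < e ^+ 2 by rewrite exprn_gt0.
(* The diagonal value is a squared norm, hence the bound [e ^+ 2]; the other factor in
   Cauchy-Schwarz is at most 1. *)
have : \forall n \near \oo, forall x, eps <= x <= 1 ->
    `|Kop (Kres n x) x| < e ^+ 2.
  apply: (KLip_uniform _ (addr_ge0 ler01 ler01) Kres_diag_KLip) => // x Ix.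
  exact: Kop_Kres_cvg0.
apply: filterS => n small x y Ix Iy nxy.
have sym : Kop (Kres n x) y = Kop (Kres n y) x.
  by rewrite -inner_Kres_Kres// innerC inner_Kres_Kres.
have far a b : I a -> I b -> eps <= a -> `|Kop (Kres n a) b| < e.
  move=> Ia Ib epsa; rewrite -inner_Kres_Kres//.
  have bk z := bmeas_Kres n z.
  apply: le_lt_trans (le_norm_inner (bk a) (bk b)) _.
  have kb : norm2 (Kres n b) <= 1 by rewrite norm2_le// expr1n inner_Kres_le1.
  apply: (@le_lt_trans _ _ (norm2 (Kres n a))).
    by rewrite ler_piMr ?norm2_ge0.
  rewrite -ltr_sqr ?nnegrE ?norm2_ge0 ?(ltW e0)// sqr_norm2 inner_Kres_Kres//.
  apply: le_lt_trans (ler_norm _) (small a _).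
  by rewrite epsa; move: Ia; rewrite I01E => /andP[].
have zero a : `|Kop (Kres n a) 0| < e by rewrite Kop_at0 normr0.
have [epsx|xeps] := leP eps x; first exact: far.
have [epsy|yeps] := leP eps y; first by rewrite sym; exact: far.
move: (Ix) (Iy); rewrite !I01E => /andP[x0 _] /andP[y0 _].
move: x0; rewrite le_eqVlt => /predU1P[x0|x0]; first by rewrite sym -x0.
move: y0; rewrite le_eqVlt => /predU1P[y0|y0]; first by rewrite -y0.
by exfalso; apply: nxy; rewrite x0 xeps y0 yeps.
Qed.

End EigenSystem.

Theorem theorem2p11 (R : realType) (phi : nat -> R -> R) (lam : nat -> R) :
  eigen_system phi lam ->
  let term := fun (x y : R) (j : nat) => phi j x * phi j y / lam j ^+ 2 in
  (* uniform convergence on [0,1]^2 \ (0,eps)^2 for each 0 < eps <= 1 *)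
  (forall eps : R, 0 < eps <= 1 ->
     exists f : R -> R -> R, forall e : R, 0 < e ->
       exists N : nat, forall n : nat, (N <= n)%N ->
         forall x y : R, x \in (@I01 R) -> y \in (@I01 R) ->
           ~ ((0 < x < eps) /\ (0 < y < eps)) ->
           `| series (term x y) n - f x y | < e) /\
  (* absolute convergence and sum = K2 for all x, y in [0,1] *)
  (forall x y : R, x \in (@I01 R) -> y \in (@I01 R) ->
     cvg (series (fun j => `| term x y j |) @ \oo) /\
     (series (term x y) @ \oo --> K2 x y)).
Proof.
move=> sys term0.
have seriesE n x y : I01 y -> series (term0 x y) n = K2 x y - Kop (Kres phi lam n x) y.
  by move=> Iy; rewrite (Kop_Kres sys)// subKr /series /= big_mkord.
split=> [eps /andP[eps0 _]|x y].
  exists (@K2 R) => e e0.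
  have [N _ NP] := Kop_Kres_uniform sys eps0 e0.
  exists N => n Nn x y; rewrite !inE => Ix Iy nxy.
  by rewrite seriesE// addrC addKr normrN; exact: NP.
rewrite !inE => Ix Iy; split; first exact: (cvg_series_abs_term sys).
rewrite (_ : series _ = fun n => K2 x y - Kop (Kres phi lam n x) y); last first.
  by apply/funext => n; exact: seriesE.
rewrite -[X in _ --> X]subr0; apply: cvgB; first exact: cvg_cst.
exact: (Kop_Kres_cvg0 sys).
Qed.
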